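(* Let $R$ be a ring such that the localization $R_L$ is coherent for each maximal ideal $L$ of $R$. If $P$ is a maximal ideal of $R$ such that $P^n$ is finitely generated for some integer $n>0$, then $P$ is finitely generated.
   Context: All rings are commutative with identity. A ring is coherent if each of its finitely generated ideals is finitely presented. *)

(* Defs.v *)
From HB Require Import structures.
From mathcomp Require Import all_boot all_algebra.
From mathcomp Require Import boolp classical_sets.
From mathcomp Require Import ring.

Set Implicit Arguments.
Unset Strict Implicit.
Unset Printing Implicit Defensive.

Import GRing.Theory.
Local Open Scope classical_set_scope.
Local Open Scope ring_scope.
Local Open Scope quotient_scope.

(* Commutative rings with identity are comPzRingType: the zero ring is allowed. *)

Section Submodules.
Variables (R : comPzRingType) (V : lmodType R).
Implicit Type N : set V.

Definition is_submodule N : Prop :=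
  N 0 /\ forall (a : R) (u v : V), N u -> N v -> N (a *: u + v).

Definition finitely_generated N : Prop :=
  exists s : seq V, N = smallest is_submodule [set` s].

End Submodules.

(* N is the cokernel of some R^m -> R^n: it is the image of a linear map from *)
(* R^n whose kernel is finitely generated.                                    *)
Definition finitely_presented (R : comPzRingType) (V : lmodType R) (N : set V) :
    Prop :=
  exists (n : nat) (f : {linear 'rV[R]_n -> V}),
    range f = N /\ finitely_generated (f @^-1` [set 0]).

Section Ideals.
Variable R : comPzRingType.
Implicit Types I J : set R^o.

Definition is_ideal I : Prop := is_submodule I.

Definition is_prime_ideal I : Prop :=
  [/\ is_ideal I, I <> setT &
      forall x y : R, I (x * y) -> I x \/ I y].

Definition is_maximal_ideal I : Prop :=
  [/\ is_ideal I, I <> setT &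
      forall J, is_ideal J -> I `<=` J -> J = I \/ J = setT].

Definition ideal_mul I J : set R^o :=
  smallest (@is_ideal) [set (x : R) * y | x in I & y in J].

Definition ideal_exp I (n : nat) : set R^o := iter n (ideal_mul I) setT.

Lemma ideal_properP I : is_ideal I -> (I <> setT) <-> ~ I 1.
Proof.
move=> [I0 IL]; split=> [IT I1|I1 IT]; last by apply: I1; rewrite IT.
apply: IT; apply/seteqP; split=> // x _.
by have := IL x 1 0 I1 I0; rewrite addr0 /GRing.scale /= mulr1.
Qed.

Lemma maximal_prime I : is_maximal_ideal I -> is_prime_ideal I.
Proof.
move=> [idI IT maxI]; split=> // x y Ixy.
have [I0 IL] := idI; have [Ix|nIx] := pselect (I x); [by left | right].
pose J : set R^o := [set z | exists a b : R, I b /\ z = a * x + b].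
have idJ : is_ideal J.
  split; first by exists 0, 0; rewrite mul0r addr0.
  move=> a _ _ [b [c [Ic ->]]] [d [e [Ie ->]]].
  exists (a * b + d), (a * c + e); split; first exact: IL.
  by rewrite /GRing.scale /= mulrDl mulrDr -!mulrA addrACA.
have IJ : I `<=` J by move=> z Iz; exists 0, z; rewrite mul0r add0r.
have Jx : J x by exists 1, 0; rewrite mul1r addr0.
case: (maxI J idJ IJ) => JE; first by case: nIx; rewrite -JE.
have [a [b [Ib E]]] : J 1 by rewrite JE.
have -> : y = a * (x * y) + (y * b + 0).
  by rewrite -[LHS]mul1r E addr0 mulrDl -mulrA [b * y]mulrC.
by apply: (IL) => //; exact: IL.
Qed.

End Ideals.

Definition coherent (R : comPzRingType) : Prop :=
  forall I : set R^o, is_ideal I -> finitely_generated I -> finitely_presented I.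

(* The ring of fractions S^-1 R of an arbitrary commutative ring R. Since R   *)
(* may have zero divisors, x/s = y/t means that u (x t - y s) = 0 for some u  *)
(* in S.                                                                      *)
Module Localization.
Section Localization.
Variables (R : comPzRingType) (S : mulrClosed R).

Definition den : Type := {s : R | s \in S}.
Definition ratio : Type := (R * den)%type.

Definition den1 : den := exist _ 1 (rpred1 S).
Definition denM (s t : den) : den :=
  exist _ (val s * val t) (rpredM (valP s) (valP t)).

Definition equivr (x y : ratio) : bool :=
  `[< exists2 u : R, u \in S & u * (x.1 * val y.2 - y.1 * val x.2) = 0 >].

Lemma equivr_refl : reflexive equivr.
Proof. by move=> x; apply/asboolP; exists 1; rewrite ?rpred1// subrr mulr0. Qed.

Lemma equivr_sym : symmetric equivr.
Proof.
suff H (x y : ratio) : equivr x y -> equivr y x by move=> x y; apply/idP/idP; apply: H.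
move=> /asboolP[u Su E]; apply/asboolP; exists u => //.
by rewrite -opprB mulrN E oppr0.
Qed.

Lemma equivr_trans : transitive equivr.
Proof.
move=> [y t] [x s] [z r] /asboolP[/= u Su E] /asboolP[/= v Sv F]; apply/asboolP.
exists (u * v * val t) => /=; first by rewrite !rpredM//; exact: valP.
suff -> : u * v * val t * (x * val r - z * val s)
   = v * val r * (u * (x * val t - y * val s))
   + u * val s * (v * (y * val r - z * val t)) by rewrite E F !mulr0 addr0.
ring.
Qed.

Canonical equivr_equiv := EquivRel equivr equivr_refl equivr_sym equivr_trans.

Definition type : Type := {eq_quot equivr}.
#[export] HB.instance Definition _ : EqQuotient _ equivr type := EqQuotient.on type.
#[export] HB.instance Definition _ := Choice.on type.

Definition frac (x : R) (s : den) : type := \pi_type (x, s).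

Lemma fracP (x y : R) (s t : den) :
  frac x s = frac y t <->
  exists2 u : R, u \in S & u * (x * val t - y * val s) = 0.
Proof.
split=> [/eqP|H]; first by rewrite /frac eqmodE => /asboolP.
by apply/eqP; rewrite /frac eqmodE; apply/asboolP.
Qed.

Lemma frac_ind (P : type -> Prop) : (forall x s, P (frac x s)) -> forall z, P z.
Proof. by move=> H z; rewrite -[z]reprK; case: (repr z) => x s; apply: H. Qed.

Definition add_ratio (x y : ratio) : ratio :=
  (x.1 * val y.2 + y.1 * val x.2, denM x.2 y.2).
Definition mul_ratio (x y : ratio) : ratio := (x.1 * y.1, denM x.2 y.2).

Definition zero : type := frac 0 den1.
Definition one : type := frac 1 den1.
Definition opp (z : type) : type := frac (- (repr z).1) (repr z).2.
Definition add (z w : type) : type := \pi_type (add_ratio (repr z) (repr w)).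
Definition mul (z w : type) : type := \pi_type (mul_ratio (repr z) (repr w)).

Lemma repr_frac (x : R) (s : den) :
  exists2 u : R, u \in S &
    u * ((repr (frac x s)).1 * val s - x * val (repr (frac x s)).2) = 0.
Proof. by apply/fracP; rewrite /frac -[RHS]reprK -surjective_pairing. Qed.

Lemma add_frac x s y t :
  add (frac x s) (frac y t) = frac (x * val t + y * val s) (denM s t).
Proof.
have [u Su E] := repr_frac x s; have [v Sv F] := repr_frac y t.
rewrite /add /add_ratio; move: (repr (frac x s)) (repr (frac y t)) E F => x' y' E F.
apply/fracP; exists (u * v) => /=; first exact: rpredM.
transitivity (v * val y'.2 * val t * (u * (x'.1 * val s - x * val x'.2))
   + u * val x'.2 * val s * (v * (y'.1 * val t - y * val y'.2)));
  last by rewrite E F !mulr0 addr0.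
by rewrite /=; ring.
Qed.

Lemma mul_frac x s y t : mul (frac x s) (frac y t) = frac (x * y) (denM s t).
Proof.
have [u Su E] := repr_frac x s; have [v Sv F] := repr_frac y t.
rewrite /mul /mul_ratio; move: (repr (frac x s)) (repr (frac y t)) E F => x' y' E F.
apply/fracP; exists (u * v) => /=; first exact: rpredM.
transitivity (v * y'.1 * val t * (u * (x'.1 * val s - x * val x'.2))
   + u * x * val x'.2 * (v * (y'.1 * val t - y * val y'.2)));
  last by rewrite E F !mulr0 addr0.
by rewrite /=; ring.
Qed.

Lemma opp_frac x s : opp (frac x s) = frac (- x) s.
Proof.
have [u Su E] := repr_frac x s; apply/fracP; exists u => //.
suff -> : u * (- (repr (frac x s)).1 * val s - - x * val (repr (frac x s)).2)
   = - (u * ((repr (frac x s)).1 * val s - x * val (repr (frac x s)).2)).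
  by rewrite E oppr0.
ring.
Qed.

Lemma frac_eq (x y : R) (s t : den) : x * val t = y * val s -> frac x s = frac y t.
Proof. by move=> E; apply/fracP; exists 1; rewrite ?rpred1// E subrr mulr0. Qed.

Fact addA : associative add.
Proof.
elim/frac_ind=> x s; elim/frac_ind=> y t; elim/frac_ind=> z r.
by rewrite !add_frac; apply: frac_eq => /=; ring.
Qed.

Fact addC : commutative add.
Proof.
elim/frac_ind=> x s; elim/frac_ind=> y t.
by rewrite !add_frac; apply: frac_eq => /=; ring.
Qed.

Fact add0 : left_id zero add.
Proof. by elim/frac_ind=> x s; rewrite add_frac; apply: frac_eq => /=; ring. Qed.

Fact addN : left_inverse zero opp add.
Proof.
by elim/frac_ind=> x s; rewrite opp_frac add_frac; apply: frac_eq => /=; ring.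
Qed.

Fact mulA : associative mul.
Proof.
elim/frac_ind=> x s; elim/frac_ind=> y t; elim/frac_ind=> z r.
by rewrite !mul_frac; apply: frac_eq => /=; ring.
Qed.

Fact mulC : commutative mul.
Proof.
elim/frac_ind=> x s; elim/frac_ind=> y t.
by rewrite !mul_frac; apply: frac_eq => /=; ring.
Qed.

Fact mul1 : left_id one mul.
Proof. by elim/frac_ind=> x s; rewrite mul_frac; apply: frac_eq => /=; ring. Qed.

Fact mulD : left_distributive mul add.
Proof.
elim/frac_ind=> x s; elim/frac_ind=> y t; elim/frac_ind=> z r.
by rewrite ?(add_frac, mul_frac); apply: frac_eq => /=; ring.
Qed.

#[export] HB.instance Definition _ := GRing.isZmodule.Build type addA addC add0 addN.
#[export] HB.instance Definition _ :=
  GRing.Zmodule_isComPzRing.Build type mulA mulC mul1 mulD.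

End Localization.
Module Exports. HB.reexport. End Exports.
End Localization.
Export Localization.Exports.

Section PrimeComplement.
Variables (R : comPzRingType) (L : set R^o) (primeL : is_prime_ideal L).

Definition prime_compl : {pred R} := [pred x | `[< ~ L x >]].

Fact prime_compl_mulr_closed : GRing.mulr_closed prime_compl.
Proof.
have [idL LT LM] := primeL; split; first by apply/asboolP/(ideal_properP idL).
move=> x y /asboolP nLx /asboolP nLy.
by apply/asboolP => /LM[].
Qed.

Definition prime_compl_mulrClosed : mulrClosed R :=
  HB.pack_for (mulrClosed R) (prime_compl : R -> bool)
    (GRing.isMulClosed.Build R prime_compl prime_compl_mulr_closed).

(* R_L: fractions with denominator outside the prime ideal L. *)
Definition localization_at : comPzRingType :=
  Localization.type prime_compl_mulrClosed.

End PrimeComplement.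

(* Main.v *)
(* Only coherence of R_P is used. Put I = P^n and let m be least with P^m      *)
(* contained in I; any x in P^(m-1) outside I has colon ideal (I : x) = P.     *)
(* Colon ideals (J : x) of finitely generated ideals of a coherent ring are    *)
(* finitely generated, so the localization of P is generated by finitely many  *)
(* fractions r_j / s_j. Every ideal N containing P^n satisfies: s x in N with  *)
(* s outside P implies x in N, because a power of 1 = a s + q, q in P, puts 1  *)
(* in R s + P^n. Applied to N = P^n + (r_j)_j, this yields P = N.              *)
Require Import Defs.
From mathcomp Require Import all_boot all_algebra.
From mathcomp Require Import boolp classical_sets.
From mathcomp Require Import ring.

Set Implicit Arguments.
Unset Strict Implicit.
Unset Printing Implicit Defensive.

Import GRing.Theory.
Local Open Scope classical_set_scope.
Local Open Scope ring_scope.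

(** The point is to exhibit [P] as a colon ideal of [P^n]. If [P^(m+1)] is the first power inside
    [P^n], some [x] in [P^m] escapes [P^n] while [P x] lies in [P^n], so maximality forces
    [(P^n : x) = P] ([exists_colon_eq_maximal]). Localizing at [P] respects this colon
    ([localized_colon]), and over the coherent ring [R_P] the colon of a finitely generated ideal by
    an element is finitely generated ([colon_finitely_generated]). For the descent, elements outside
    [P] are units modulo [P^n], so an ideal containing [P^n] is recovered from its localization;
    generators of [P^n] and numerators of generators of the localized [P] together generate [P]
    ([finitely_generated_of_localized]). *)

Section SubmoduleTheory.
Variables (R : comPzRingType) (V : lmodType R).
Implicit Type N : set V.

Lemma submoduleD N u v : is_submodule N -> N u -> N v -> N (u + v).
Proof. by move=> [_ NL] Nu Nv; rewrite -[u]scale1r; apply: NL. Qed.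

Lemma submoduleZ N a u : is_submodule N -> N u -> N (a *: u).
Proof. by move=> [N0 NL] Nu; rewrite -[_ *: _]addr0; apply: NL. Qed.

Lemma submoduleB N u v : is_submodule N -> N u -> N v -> N (u - v).
Proof.
by move=> sN Nu Nv; apply: submoduleD => //; rewrite -scaleN1r; apply: submoduleZ.
Qed.

Lemma smallest_submodule (G : set V) :
  is_submodule (smallest (@is_submodule R V) G).
Proof.
split=> [N [[]]//|a u v Gu Gv N [sN GN]].
by apply: sN.2; [apply: Gu | apply: Gv].
Qed.

Lemma finitely_generated_submodule N : finitely_generated N -> is_submodule N.
Proof. by move=> [s ->]; apply: smallest_submodule. Qed.

(** Testing against every submodule [N'] containing [s] replaces explicit linear combinations of
    [s]. *)
Lemma finitely_generatedI N (s : seq V) :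
    is_submodule N -> (forall v, v \in s -> N v) ->
    (forall N', is_submodule N' -> (forall v, v \in s -> N' v) -> N `<=` N') ->
  finitely_generated N.
Proof.
move=> sN sub gen; exists s; apply/seteqP; split; last exact: smallest_sub.
by apply: gen; [apply: smallest_submodule | apply: sub_gen_smallest].
Qed.

End SubmoduleTheory.

(** * Colon ideals over a coherent ring *)

Section Colon.
Variable R : comPzRingType.
Implicit Type I : set R^o.

Definition colon I (x : R) : set R^o := [set c : R^o | I (c * x)].

Lemma is_ideal_colon I x : is_ideal I -> is_ideal (colon I x).
Proof.
move=> idI; split; first by rewrite /colon /= mul0r; apply: idI.1.
move=> a u v Iu Iv; rewrite /colon /=.
have -> : (a *: u + v : R) * x = a *: (u * x : R^o) + v * x.
  by rewrite /GRing.scale /=; ring.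
exact: idI.2.
Qed.

(** Coherence presents [J = I + R x] by a map [f]. When [c x] lies in [I], it has one preimage built
    from [x] and one built from the generators of [I]; they differ by a relation, and the relations
    are spanned by the finite list [K]. *)
Lemma colon_finitely_generated I x :
  coherent R -> finitely_generated I -> finitely_generated (colon I x).
Proof.
move=> cohR fgI; have idI := finitely_generated_submodule fgI.
have [g Ig] := fgI.
pose J : set R^o := [set y : R^o | exists b : R, I (y - b * x)].
have idJ : is_ideal J.
  split; first by exists 0; rewrite mul0r subr0; apply: idI.1.
  move=> a u v [b Ib] [d Id]; exists (a * b + d).
  have -> : a *: u + v - (a * b + d) * x = a *: (u - b * x) + (v - d * x).
    by rewrite /GRing.scale /=; ring.
  exact: idI.2.
have IJ : I `<=` J by move=> y Iy; exists 0; rewrite mul0r subr0.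
have Jx : J x by exists 1; rewrite mul1r subrr; apply: idI.1.
have fgJ : finitely_generated J.
  apply: (finitely_generatedI (s := (x : R^o) :: g)) => //.
    move=> v; rewrite inE => /orP[/eqP->//|gv].
    by apply: IJ; rewrite Ig; apply: sub_gen_smallest.
  move=> N' sN' N's y [b Ib].
  have -> : y = b *: (x : R^o) + (y - b * x) by rewrite /GRing.scale /=; ring.
  apply: sN'.2; first by apply: N's; rewrite mem_head.
  move: Ib; rewrite Ig; apply: smallest_sub => // v gv.
  by apply: N's; rewrite inE; apply/orP; right.
have [n [f [fJ [K kerf]]]] := cohR J idJ fgJ.
have [lift liftP] : {lift : R^o -> 'rV[R]_n & forall y, J y -> f (lift y) = y}.
  apply: (choice (P := fun y w => J y -> f w = y)) => y.
  have [Jy|nJy] := pselect (J y); last by exists 0.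
  by move: Jy; rewrite -fJ => -[w _ <-]; exists w.
have [b bP] : {b : 'I_n -> R & forall j, I (f (delta_mx 0 j) - b j * x)}.
  apply: (choice (P := fun j bj => I (f (delta_mx 0 j) - bj * x))) => j.
  by suff: J (f (delta_mx 0 j)) by []; rewrite -fJ; exists (delta_mx 0 j).
pose phi (w : 'rV[R]_n) : R^o := \sum_j w 0 j * b j.
have phiL a u v : phi (a *: u + v) = a *: phi u + phi v.
  rewrite /phi scaler_sumr -big_split; apply: eq_bigr => j _ /=.
  by rewrite !mxE /GRing.scale /=; ring.
have phi0 : phi 0 = 0 by rewrite /phi big1 // => j _; rewrite mxE mul0r.
(* phi reads off a coefficient of x in f w, modulo I. *)
have fphi w : I (f w - phi w * x).
  rewrite {1}[w]row_sum_delta linear_sum /phi mulr_suml -sumrB.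
  elim/big_ind: _ => [|u v|j _]; [exact: idI.1 | exact: submoduleD |].
  by rewrite linearZ -mulrA -mulrBr; apply: submoduleZ.
have phi_colon w : I (f w) -> colon I x (phi w).
  move=> Ifw; rewrite /colon /= -[_ * _](subKr (f w)).
  exact: submoduleB.
have kerP w : w \in K -> f w = 0.
  by move=> Kw; suff: (f @^-1` [set 0]) w by []; rewrite kerf; apply: sub_gen_smallest.
(* The first generator compares the coefficient 1 of [x] with the one read off [lift x]; the others
   come from the relations and from lifts of the generators of [I]. *)
apply: (finitely_generatedI
  (s := (1 - phi (lift x) : R^o) :: map phi K ++ map (phi \o lift) g)).
- exact: is_ideal_colon.
- move=> c; rewrite inE mem_cat => /or3P[/eqP->|/mapP[w Kw ->]|/mapP[y gy ->]].
  + by rewrite /colon /= mulrBl mul1r -{1}(liftP x Jx); apply: fphi.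
  + by apply: phi_colon; rewrite kerP //; apply: idI.1.
  + have Iy : I y by rewrite Ig; apply: sub_gen_smallest.
    by apply: phi_colon; rewrite liftP //; apply: IJ.
move=> N sN Ns c Icx.
have Nker w : f w = 0 -> N (phi w).
  move=> fw0; have : (f @^-1` [set 0]) w by [].
  rewrite kerf; apply: (smallest_sub (X := [set w | N (phi w)])).
    by split=> [|a u v Nu Nv] /=; rewrite ?phi0 ?phiL; [apply: sN.1 | apply: sN.2].
  by move=> v Kv; apply: Ns; rewrite inE mem_cat map_f // orbT.
(* [lift] need not be linear, so [w] is a combination of the lifts of [g] rather than
   [lift (c * x)]; this keeps [phi w] in [N]. *)
have [w [fw Nw]] : exists w, f w = c * x /\ N (phi w).
  move: Icx; rewrite /colon /= Ig.
  apply: (smallest_sub (X := [set y | exists w, f w = y /\ N (phi w)])).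
    split=> [|a _ _ [u [<- Nu]] [v [<- Nv]]].
      by exists 0; rewrite linear0 phi0; split=> //; apply: sN.1.
    by exists (a *: u + v); rewrite linearP phiL; split=> //; apply: sN.2.
  move=> y gy; exists (lift y); split.
    by apply: liftP; apply: IJ; rewrite Ig; apply: sub_gen_smallest.
  by apply: Ns; rewrite inE mem_cat (map_f (phi \o lift)) // !orbT.
(* Both [c *: lift x] and [w] map to [c * x], so their difference is a relation, which [phi] sends
   into [N]. *)
have -> : c = c *: (1 - phi (lift x) : R^o) + (phi (c *: lift x + (- 1) *: w) + phi w).
  have := phiL (- 1) w 0; rewrite phi0 !addr0 => phiN.
  by rewrite phiL phiN /GRing.scale /=; ring.
apply: sN.2; first by apply: Ns; rewrite mem_head.
apply: submoduleD => //; apply: Nker.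
by rewrite linearP linearZ /= fw liftP // /GRing.scale /=; ring.
Qed.

End Colon.

(** * Powers of a maximal ideal *)

Section IdealPowers.
Variables (R : comPzRingType) (P : set R^o).

Lemma is_ideal_exp n : is_ideal (ideal_exp P n).
Proof. by case: n => [|n]; [split | apply: smallest_submodule]. Qed.

Lemma ideal_expS n (p x : R) :
  P p -> ideal_exp P n x -> ideal_exp P n.+1 (p * x).
Proof. by move=> Pp Pnx; apply: sub_gen_smallest; exists p => //; exists x. Qed.

Lemma ideal_exp_expr n (p : R) : P p -> ideal_exp P n (p ^+ n).
Proof. by move=> Pp; elim: n => // n IHn; rewrite exprS; apply: ideal_expS. Qed.

Lemma ideal_expS_sub n : is_ideal P -> ideal_exp P n.+1 `<=` P.
Proof.
move=> idP; apply: smallest_sub => // _ [p Pp [x _ <-]].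
by rewrite mulrC; apply: (submoduleZ (V := R^o)).
Qed.

Hypothesis maxP : is_maximal_ideal P.

Lemma maximal_ideal_bezout (s : R) : ~ P s -> exists a : R, P (1 - a * s).
Proof.
move=> nPs; have [idP _ maxlP] := maxP.
pose J : set R^o := [set y : R^o | exists a : R, P (y - a * s)].
have idJ : is_ideal J.
  split; first by exists 0; rewrite mul0r subr0; apply: idP.1.
  move=> a u v [b Pb] [d Pd]; exists (a * b + d).
  have -> : a *: u + v - (a * b + d) * s = a *: (u - b * s) + (v - d * s).
    by rewrite /GRing.scale /=; ring.
  exact: idP.2.
have PJ : P `<=` J by move=> y Py; exists 0; rewrite mul0r subr0.
have Js : J s by exists 1; rewrite mul1r subrr; apply: idP.1.
by case: (maxlP J idJ PJ) => JE; [case: nPs; rewrite -JE | suff: J 1 by []; rewrite JE].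
Qed.

(** An inverse of [s] modulo [P] lifts to one modulo [P^n]: expand the [n]-th power of [1 - a * s],
    an element of [P]. *)
Lemma maximal_ideal_exp_bezout n (s : R) :
  ~ P s -> exists a : R, ideal_exp P n (1 - a * s).
Proof.
move=> nPs; have [a Pas] := maximal_ideal_bezout nPs.
have [b Eb] : exists b : R, (1 - a * s) ^+ n = 1 - b * s.
  elim: n => [|n [b Eb]]; first by exists 0; rewrite expr0 mul0r subr0.
  by exists (a + b - a * b * s); rewrite exprS Eb; ring.
by exists b; rewrite -Eb; apply: ideal_exp_expr.
Qed.

Lemma ideal_cancel n (N : set R^o) (s x : R) : is_ideal N ->
  ideal_exp P n `<=` N -> ~ P s -> N (s * x) -> N x.
Proof.
move=> idN PnN nPs Nsx; have [a Pas] := maximal_ideal_exp_bezout n nPs.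
have -> : x = a *: (s * x : R^o) + (x *: (1 - a * s : R^o)).
  by rewrite /GRing.scale /=; ring.
by apply: idN.2 => //; apply: submoduleZ => //; apply: PnN.
Qed.

Lemma exists_colon_eq_maximal n : (0 < n)%N ->
  exists x : R, colon (ideal_exp P n) x = P.
Proof.
move=> n0; have [idP PT maxlP] := maxP.
have exm : exists m, `[< ideal_exp P m `<=` ideal_exp P n >] by exists n; apply/asboolP.
case: (ex_minnP exm) => -[/asboolP le0 _|m /asboolP leS minm].
  (* Exponent 0 is excluded: [P^0] is the whole ring, while [P^n] lies in [P]. *)
  case: PT; apply/seteqP; split=> // x _.
  by case: n n0 le0 {exm} => // n _ le0; apply: (@ideal_expS_sub n) => //; apply: le0.
have [x Pmx nPnx] : exists2 x : R, ideal_exp P m x & ~ ideal_exp P n x.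
  (* Otherwise [P^m] would already lie in [P^n], against the minimality of [m.+1]. *)
  apply: contrapT => nex; suff: (m < m)%N by rewrite ltnn.
  apply/minm/asboolP => x Pmx; apply: contrapT => nPnx.
  by apply: nex; exists x.
exists x.
have Pcolon : P `<=` colon (ideal_exp P n) x.
  by move=> p Pp; apply: leS; apply: ideal_expS.
case: (maxlP _ (is_ideal_colon x (is_ideal_exp n)) Pcolon) => // E.
by case: nPnx; rewrite -[x]mul1r; suff: colon (ideal_exp P n) x 1 by []; rewrite E.
Qed.

End IdealPowers.

(** * Passage to the localization at [P] and back *)

Section LocalizedIdeal.
Variables (R : comPzRingType) (P : set R^o) (maxP : is_maximal_ideal P).

Let S := prime_compl_mulrClosed (maximal_prime maxP).
Let A : comPzRingType := localization_at (maximal_prime maxP).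

(** The extension of [N] to [R_P]; only one representative needs its numerator in [N]. *)
Definition localized_ideal (N : set R^o) : set A^o :=
  [set z | exists (y : R) (s : Localization.den S),
     N y /\ z = Localization.frac y s].

Lemma is_ideal_localized N : is_ideal N -> is_ideal (localized_ideal N).
Proof.
move=> idN; split.
  by exists 0, (Localization.den1 S); split=> //; apply: idN.1.
move=> z _ _ [u [s [Nu ->]]] [v [t [Nv ->]]].
elim/Localization.frac_ind: z => a r.
exists (a * u * val t + v * (val r * val s)).
exists (Localization.denM (Localization.denM r s) t); split; last first.
  transitivity (Localization.add (Localization.mul (Localization.frac a r)
    (Localization.frac u s)) (Localization.frac v t)) => //.
  by rewrite Localization.mul_frac Localization.add_frac.
have -> : a * u * val t + v * (val r * val s)
    = (a * val t) *: (u : R^o) + (val r * val s) *: (v : R^o).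
  by rewrite /GRing.scale /=; ring.
by apply: idN.2 => //; apply: submoduleZ.
Qed.

(** Equality of [x / s] and [y / t] only gives [u t x = u s y]; since [u t] is outside [P], it
    cancels modulo any ideal above [P^n]. *)
Lemma localized_ideal_frac n (N : set R^o) (x : R) (s : Localization.den S) :
    is_ideal N -> ideal_exp P n `<=` N ->
  localized_ideal N (Localization.frac x s) -> N x.
Proof.
move=> idN PnN [y [t [Ny /Localization.fracP[u Su E]]]].
apply: (ideal_cancel maxP (n := n) (s := u * val t)) => //.
  by apply/asboolP; apply: (rpredM (s := S)) Su (valP t).
have -> : u * val t * x = (u * val s) *: (y : R^o).
  apply/eqP; rewrite -subr_eq0 -E /GRing.scale /=; apply/eqP; ring.
exact: submoduleZ.
Qed.

Lemma localized_ideal_finitely_generated N :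
  finitely_generated N -> finitely_generated (localized_ideal N).
Proof.
move=> fgN; have idN := finitely_generated_submodule fgN.
have [g Ng] := fgN.
pose iota (y : R^o) : A^o := Localization.frac (S := S) y (Localization.den1 S).
apply: (finitely_generatedI (s := map iota g)).
- exact: is_ideal_localized.
- move=> _ /mapP[y gy ->]; exists y, (Localization.den1 S); split=> //.
  by rewrite Ng; apply: sub_gen_smallest.
move=> N' sN' N's _ [y [s [Ny ->]]].
have -> : (Localization.frac (S := S) y s : A^o)
    = (Localization.frac 1 s : A) *: (iota y : A^o).
  transitivity (Localization.mul (Localization.frac 1 s)
    (Localization.frac y (Localization.den1 S))) => //.
  by rewrite Localization.mul_frac; apply: Localization.frac_eq => /=; ring.
apply: submoduleZ => //; move: Ny; rewrite Ng.
apply: (smallest_sub (X := [set y | N' (iota y)])); last first.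
  by move=> v gv; apply: N's; apply: map_f.
split; first exact: sN'.1.
move=> a u v N'u N'v /=.
have -> : iota (a *: u + v) = (iota a : A) *: iota u + iota v.
  transitivity (Localization.add (Localization.mul (iota a) (iota u)) (iota v)) => //.
  rewrite Localization.mul_frac Localization.add_frac.
  by apply: Localization.frac_eq; rewrite /GRing.scale /=; ring.
exact: sN'.2.
Qed.

Lemma finitely_generated_of_localized n (N : set R^o) :
    is_ideal N -> ideal_exp P n `<=` N -> finitely_generated (ideal_exp P n) ->
  finitely_generated (localized_ideal N) -> finitely_generated N.
Proof.
move=> idN PnN [g Pg] [c Nc].
pose num (z : A^o) : R^o := (repr (z : Localization.type S)).1.
have numP (z : A^o) : exists s : Localization.den S, z = Localization.frac (S := S) (num z) s.
  exists (repr (z : Localization.type S)).2.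
  by rewrite /Localization.frac -surjective_pairing reprK.
apply: (finitely_generatedI (s := g ++ map num c)) => //.
  move=> v; rewrite mem_cat => /orP[gv|/mapP[z cz ->]].
    by apply: PnN; rewrite Pg; apply: sub_gen_smallest.
  have [s zE] := numP z; apply: (localized_ideal_frac (s := s)) PnN _ => //.
  by rewrite -zE Nc; apply: sub_gen_smallest.
move=> N' idN' N's x Nx.
(* Listing the generators of [P^n] serves here: it allows denominators to be cancelled in [N']
   too. *)
have PnN' : ideal_exp P n `<=` N'.
  by rewrite Pg; apply: smallest_sub => // v gv; apply: N's; rewrite mem_cat gv.
apply: (localized_ideal_frac (s := Localization.den1 S)) PnN' _ => //.
have : localized_ideal N (Localization.frac (S := S) x (Localization.den1 S)).
  by exists x, (Localization.den1 S).
rewrite Nc; apply: smallest_sub; first exact: is_ideal_localized.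
move=> z cz; have [s zE] := numP z; exists (num z), s; split=> //.
by apply: N's; rewrite mem_cat map_f ?orbT.
Qed.

Lemma localized_colon n (x : R) :
  localized_ideal (colon (ideal_exp P n) x)
  = colon (localized_ideal (ideal_exp P n))
      (Localization.frac x (Localization.den1 S) : A).
Proof.
have mulx r s : (Localization.frac r s : A)
    * (Localization.frac x (Localization.den1 S) : A)
    = Localization.frac (r * x) (Localization.denM s (Localization.den1 S)).
  exact: Localization.mul_frac.
apply/seteqP; split=> [_ [r [s [Ir ->]]]|].
  by rewrite /colon /= mulx; exists (r * x), (Localization.denM s (Localization.den1 S)).
elim/Localization.frac_ind=> r s; rewrite /colon /= mulx => Irx; exists r, s; split=> //.
(* The denominators are cancelled in [P^n] itself. *)
exact: localized_ideal_frac (is_ideal_exp P n) (@subset_refl _ _) Irx.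
Qed.

End LocalizedIdeal.

Theorem theorem2p2 (R : comPzRingType)
    (R_loc_coherent : forall (L : set R^o) (maxL : is_maximal_ideal L),
       coherent (localization_at (maximal_prime maxL)))
    (P : set R^o) (maxP : is_maximal_ideal P)
    (Pn_fg : exists2 n : nat, (0 < n)%N & finitely_generated (ideal_exp P n)) :
  finitely_generated P.
Proof.
have [n n0 fgPn] := Pn_fg; have [idP _ _] := maxP.
have [x colonE] := exists_colon_eq_maximal maxP n0.
have PnP : ideal_exp P n `<=` P.
  by case: n n0 {fgPn colonE} => // n _; apply: ideal_expS_sub.
apply: (finitely_generated_of_localized (maxP := maxP) idP PnP fgPn).
have -> : localized_ideal (maxP := maxP) P
    = localized_ideal (colon (ideal_exp P n) x).
  by rewrite colonE.
rewrite localized_colon.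
apply: colon_finitely_generated; first exact: R_loc_coherent.
exact: localized_ideal_finitely_generated.
Qed.
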